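(* Consider integers $n\ge 0$, $l\ge 1$ and $b$ with $2 \leq b \leq 10$. \begin{enumerate} \item The solutions $(n,b,l)$ of $E_{n} = (b+1)b^l-1$ are exactly $(5,2,1), (6,2,1), (12,5,1)$; thus the Thabit numbers of the first kind base $b$ which are Perrin numbers are $5$ and $29$. \item The only solution $(n,b,l)$ of $E_{n} = (b+1)b^l+1$ is $(7,2,1)$; thus the only Thabit number of the second kind base $b$ which is a Perrin number is $7$. \item The solutions $(n,b,l)$ of $E_{n} = (b-1)b^l-1$ are exactly $(0,2,2), (3,2,2), (5,3,1), (6,3,1), (7,2,3), (10,3,2), (12,6,1)$; thus the Williams numbers of the first kind base $b$ which are Perrin numbers are $3, 5, 7, 17, 29$. \item The solutions $(n,b,l)$ of $E_{n} = (b-1)b^l+1$ are exactly $(0,2,1), (3,2,1), (5,2,2), (6,2,2), (7,3,1), (10,2,4)$; thus the Williams numbers of the second kind base $b$ which are Perrin numbers are $3, 5, 7, 17$. \end{enumerate}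
   Context: $(E_n)_{n\ge 0}$ denotes the Perrin sequence: $E_0=3$, $E_1=0$, $E_2=2$ and $E_{n+3}=E_{n+1}+E_n$ for all $n\ge 0$. For an integer $b\ge 2$ and $l\ge 1$: a Thabit number of the first kind base $b$ is $(b+1)b^l-1$, of the second kind is $(b+1)b^l+1$; a Williams number of the first kind base $b$ is $(b-1)b^l-1$, of the second kind is $(b-1)b^l+1$. *)

(* Defs.v *)
From mathcomp Require Import all_boot.

Set Implicit Arguments.
Unset Strict Implicit.
Unset Printing Implicit Defensive.

Fixpoint perrin (n : nat) : nat :=
  match n with
  | 0 => 3
  | 1 => 0
  | 2 => 2
  | (k.+1 as k1).+2 => perrin k1 + perrin k
  end.

Lemma perrinSSS (n : nat) : perrin n.+3 = perrin n.+1 + perrin n.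
Proof. by []. Qed.

Definition is_perrin (x : nat) : Prop := exists n : nat, x = perrin n.

(* For b >= 2 and l >= 1 we have (b + 1) * b ^ l >= (b - 1) * b ^ l >= 2, so
   none of the subtractions below is truncated. *)
Definition is_thabit1 (b x : nat) : Prop :=
  exists l : nat, 1 <= l /\ x = (b + 1) * b ^ l - 1.

Definition is_thabit2 (b x : nat) : Prop :=
  exists l : nat, 1 <= l /\ x = (b + 1) * b ^ l + 1.

Definition is_williams1 (b x : nat) : Prop :=
  exists l : nat, 1 <= l /\ x = (b - 1) * b ^ l - 1.

Definition is_williams2 (b x : nat) : Prop :=
  exists l : nat, 1 <= l /\ x = (b - 1) * b ^ l + 1.

(* Main.v *)
From Stdlib Require Import NArith Lia.
Require Import Defs.
From mathcomp Require Import all_boot zify.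

(** Fix [b] and suppose [l >= k].  The equation then reads
    [E_n -+ 1 = C * b ^ m] with [C = (b +- 1) * b ^ k] and [m = l - k].  Modulo
    a power of a prime dividing [b] the right-hand side vanishes, which leaves
    only a few classes for [n]; modulo further small primes, both the Perrin
    sequence and [C * b ^ m] are periodic with small periods, and a handful of
    such moduli, chosen by a computer search, rules out every pair of residues
    of [(n, m)].  Hence [l < k], so [E_n] is small and a finite search remains. *)

Set Implicit Arguments.
Unset Strict Implicit.
Unset Printing Implicit Defensive.

Lemma mem_map_iota (T : eqType) (f : nat -> T) (m i : nat) :
  i < m -> f i \in [seq f j | j <- iota 0 m].
Proof. by move=> im; apply: map_f; rewrite mem_iota. Qed.

(** * Residues of both sides and their periods *)

Local Open Scope N_scope.

(** Only residues in binary are kept: the terms themselves, at indices in the thousands, could not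
    be evaluated. *)
Fixpoint perrin_tab (q : N) (m : nat) (x y z : N) : seq N :=
  if m is m'.+1 then x :: perrin_tab q m' y z ((x + y) mod q) else [::].

Fixpoint geom_tab (q b : N) (m : nat) (x : N) : seq N :=
  if m is m'.+1 then x :: geom_tab q b m' ((x * b) mod q) else [::].

Definition perrinN (n : nat) : N := N.of_nat (perrin n).

Lemma perrinN_SSS (n : nat) : perrinN n.+3 = perrinN n.+1 + perrinN n.
Proof. by rewrite /perrinN perrinSSS Nat2N.inj_add. Qed.

Lemma nth_perrin_tab (q : N) (m i j : nat) : q <> 0 -> (j < m)%N ->
  nth 0 (perrin_tab q m (perrinN i mod q) (perrinN i.+1 mod q)
                        (perrinN i.+2 mod q)) j
  = perrinN (i + j)%N mod q.
Proof.
move=> q0; elim: m i j => [//|m IHm] i [|j] jm /=; first by rewrite addn0.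
have -> : (perrinN i mod q + perrinN i.+1 mod q) mod q = perrinN i.+3 mod q.
  by rewrite -N.Div0.add_mod perrinN_SSS N.add_comm.
by rewrite IHm // addSnnS.
Qed.

Lemma nth_geom_tab (q b C : N) (m i j : nat) : q <> 0 -> (j < m)%N ->
  nth 0 (geom_tab q b m ((C * b ^ N.of_nat i) mod q)) j
  = (C * b ^ N.of_nat (i + j)%N) mod q.
Proof.
move=> q0; elim: m i j => [//|m IHm] i [|j] jm /=; first by rewrite addn0.
rewrite N.Div0.mul_mod_idemp_l.
have -> : C * b ^ N.of_nat i * b = C * b ^ N.of_nat i.+1.
  by rewrite Nat2N.inj_succ N.pow_succ_r'; lia.
by rewrite IHm // addSnnS.
Qed.

(** Three consecutive residues determine all later ones, so one coincidence of such triples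
    propagates. *)
Lemma perrinN_periodic (q : N) (p : nat) : q <> 0 ->
  perrinN p mod q = perrinN 0 mod q ->
  perrinN p.+1 mod q = perrinN 1 mod q ->
  perrinN p.+2 mod q = perrinN 2 mod q ->
  forall n, perrinN (p + n)%N mod q = perrinN n mod q.
Proof.
move=> q0 h0 h1 h2 n.
suff [] : [/\ perrinN (p + n)%N mod q = perrinN n mod q,
              perrinN (p + n.+1)%N mod q = perrinN n.+1 mod q
            & perrinN (p + n.+2)%N mod q = perrinN n.+2 mod q] by [].
elim: n => [|n [IH0 IH1 IH2]]; first by rewrite addn0 addn1 addn2.
split=> //; rewrite !addnS !perrinN_SSS -!addnS N.Div0.add_mod IH0 IH1.
by rewrite -N.Div0.add_mod.
Qed.

Lemma periodic_mod (T : Type) (f : nat -> T) (p : nat) :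
  (forall n, f (p + n)%N = f n) -> forall n, f n = f (n %% p)%N.
Proof.
move=> fp n; rewrite {1}(divn_eq n p); elim: (n %/ p)%N => [|j IH] //.
by rewrite mulSn -addnA fp.
Qed.

(** * The sieve on pairs of exponents *)

(* Residues [(r, t)] modulo [(nmod, mmod)] of the exponents [(n, m)] in
   [E_n + d1 = C * b ^ m + d2]. *)
Record state := State { nmod : N; mmod : N; classes : seq (N * N) }.

Definition lifts (M M' r : N) : seq N :=
  [seq r + M * N.of_nat i | i <- iota 0 (N.to_nat (M' / M))].

(* [(q, p, o)] stands for a modulus [q] with alleged periods [p] of [E_n] and
   [o] of [C * b ^ m] modulo [q]; a false allegation leaves the state unchanged. *)
Definition refine_step (b C d1 d2 : N) (S : state) (c : nat * nat * nat) : state :=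
  let: (q', p, o) := c in
  let q := N.of_nat q' in
  (* The entries beyond one period, three here and one in [G], serve to test the alleged periods. *)
  let E := perrin_tab q p.+3 (3 mod q) (0 mod q) (2 mod q) in
  let G := geom_tab q b o.+1 (C mod q) in
  if [&& q != 0, (0 < p)%N, (0 < o)%N,
         nth 0 E p == nth 0 E 0, nth 0 E p.+1 == nth 0 E 1,
         nth 0 E p.+2 == nth 0 E 2 & nth 0 G o == nth 0 G 0]
  then
    let P := N.of_nat p in
    let O := N.of_nat o in
    let M := N.lcm (nmod S) P in
    let L := N.lcm (mmod S) O in
    State M L
      [seq x <- flatten [seq [seq (r, t) | r <- lifts (nmod S) M rt.1,
                                           t <- lifts (mmod S) L rt.2]
                        | rt <- classes S]
      | (nth 0 E (N.to_nat (x.1 mod P)) + d1) mod q ==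
        (nth 0 G (N.to_nat (x.2 mod O)) + d2) mod q]
  else S.

Definition sieve (b C d1 d2 : N) (cs : seq (nat * nat * nat)) : state :=
  foldl (refine_step b C d1 d2) (State 1 1 [:: (0, 0)]) cs.

Definition covers (S : state) (n m : nat) : Prop :=
  [/\ nmod S <> 0, mmod S <> 0
    & (N.of_nat n mod nmod S, N.of_nat m mod mmod S) \in classes S].

(** With [M' = k * M], the residue of [x] modulo [M'] is [x mod M + M * ((x / M) mod k)], and the
    last factor is below [k]. *)
Lemma mem_lifts (M M' x : N) : M <> 0 -> M' <> 0 -> (M | M') ->
  x mod M' \in lifts M M' (x mod M).
Proof.
move=> M0 M'0 [k M'E]; subst M'.
have k0 : k <> 0 by lia.
have -> : x mod (k * M) = x mod M + M * N.of_nat (N.to_nat ((x / M) mod k)).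
  by rewrite N2Nat.id N.mul_comm N.Div0.mod_mul_r.
apply: (mem_map_iota (fun i => x mod M + M * N.of_nat i)).
rewrite N.div_mul //; have := N.mod_lt (x / M) k k0; lia.
Qed.

Lemma lcm_neq0 (x y : N) : x <> 0 -> y <> 0 -> N.lcm x y <> 0.
Proof. by move=> x0 y0 /N.lcm_eq_0[]. Qed.

Lemma to_nat_mod_mod (x : nat) (M : N) (p : nat) :
  (0 < p)%N -> M <> 0 -> (N.of_nat p | M) ->
  N.to_nat ((N.of_nat x mod M) mod N.of_nat p) = (x %% p)%N.
Proof.
move=> p0 M0 [k ->]; have P0 : N.of_nat p <> 0 by lia.
rewrite N.mul_comm N.Div0.mod_mul_r N.mul_comm N.Div0.mod_add.
rewrite N.Div0.mod_mod -Nat2N.inj_mod Nat2N.id.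
symmetry; apply: (PeanoNat.Nat.mod_unique x p (x %/ p)); lia.
Qed.

(** Once the periods are verified, both sides modulo [q] depend only on the classes of [n] and [m],
    so the class of a true solution passes the filter. *)
Lemma covers_refine_step (b C d1 d2 : N) (S : state) (c : nat * nat * nat)
    (n m : nat) :
  perrinN n + d1 = C * b ^ N.of_nat m + d2 ->
  covers S n m -> covers (refine_step b C d1 d2 S c) n m.
Proof.
case: c => [[q' p] o] eqn covS; rewrite /refine_step.
set q := N.of_nat q'.
set E := perrin_tab _ _ _ _ _; set G := geom_tab _ _ _ _.
case: ifP => // /and5P[/eqP q0 p0 o0 /eqP E0 /and3P[/eqP E1 /eqP E2 /eqP G0]].
have nthE j : (j < p.+3)%N -> nth 0 E j = perrinN j mod q.
  exact: (@nth_perrin_tab q p.+3 0).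
have nthG j : (j < o.+1)%N -> nth 0 G j = (C * b ^ N.of_nat j) mod q.
  by move=> jo; rewrite -(@nth_geom_tab q b C o.+1 0) // N.mul_1_r.
have perE k : perrinN k mod q = perrinN (k %% p)%N mod q.
  apply: (periodic_mod (f := fun k => perrinN k mod q)) => {}k.
  by apply: perrinN_periodic; rewrite // -!nthE //; lia.
have perG k : (C * b ^ N.of_nat k) mod q = (C * b ^ N.of_nat (k %% o)%N) mod q.
  apply: (periodic_mod (f := fun k => (C * b ^ N.of_nat k) mod q)) => {}k.
  (* The test is [C * b ^ o = C] modulo [q], not [b ^ o = 1], so [q] may share factors with [b]. *)
  rewrite !nthG // in G0.
  rewrite Nat2N.inj_add N.pow_add_r N.mul_assoc N.Div0.mul_mod G0.
  by rewrite -N.Div0.mul_mod N.mul_1_r.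
case: covS => M0 L0 memS.
have P0 : N.of_nat p <> 0 by lia.
have O0 : N.of_nat o <> 0 by lia.
have M'0 := lcm_neq0 M0 P0; have L'0 := lcm_neq0 L0 O0.
split=> //=; rewrite mem_filter /=; apply/andP; split.
  rewrite !to_nat_mod_mod //; try exact: N.divide_lcm_r.
  rewrite nthE; last by have := ltn_pmod n p0; lia.
  rewrite nthG; last by have := ltn_pmod m o0; lia.
  by rewrite -perE -perG !N.Div0.add_mod_idemp_l eqn.
apply/flattenP; eexists; first exact: map_f memS.
by apply: allpairs_f; apply: mem_lifts => //; exact: N.divide_lcm_l.
Qed.

Lemma covers_sieve (b C d1 d2 : N) (cs : seq (nat * nat * nat)) (n m : nat) :
  perrinN n + d1 = C * b ^ N.of_nat m + d2 ->
  covers (sieve b C d1 d2 cs) n m.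
Proof.
move=> eqn; rewrite /sieve.
(* Modulo 1 the single class contains every pair. *)
have: covers (State 1 1 [:: (0, 0)]) n m by split=> //=; rewrite !N.mod_1_r.
elim: cs (State _ _ _) => //= c cs IHcs S covS.
by apply: IHcs; apply: covers_refine_step.
Qed.

(** The first moduli are the prime powers exactly dividing [b ^ k], where the right-hand side is
    constant (period 1); the others are primes not dividing [b]. One entry per base serves all four
    equations. The default certifies nothing, since an empty list leaves one class. *)
Definition certificate (b : nat) : nat * seq (nat * nat * nat) :=
  match b with
  | 2 => (5, [:: (32, 112, 1); (7, 48, 3); (5, 24, 4); (17, 288, 8);
                 (3361, 3360, 168)])
  | 3 => (4, [:: (81, 351, 1); (5, 24, 4); (53, 1404, 52); (79, 3120, 78);
                 (271, 270, 30)])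
  | 4 => (2, [:: (16, 56, 1); (5, 24, 2); (7, 48, 3); (17, 288, 4);
                 (3361, 3360, 84)])
  | 5 => (2, [:: (25, 120, 1); (11, 120, 5); (211, 210, 35)])
  | 6 => (2, [:: (4, 14, 1); (9, 39, 1); (43, 231, 3); (23, 22, 11);
                 (463, 231, 66)])
  | 7 => (2, [:: (49, 336, 1); (5, 24, 4); (17, 288, 16); (449, 224, 112)])
  | 8 => (2, [:: (64, 224, 1); (7, 48, 1); (5, 24, 4); (449, 224, 224)])
  | 9 => (2, [:: (81, 351, 1); (5, 24, 2); (53, 1404, 26); (79, 3120, 39);
                 (19, 180, 9)])
  | 10 => (2, [:: (4, 14, 1); (25, 120, 1); (11, 120, 2); (7, 48, 6);
                  (211, 210, 30)])
  | _ => (0, [::])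
  end%N.

Definition certified (b c : nat) (d1 d2 : N) : bool :=
  let: (k, cs) := certificate b in
  nilp (classes (sieve (N.of_nat b) (N.of_nat c * N.of_nat b ^ N.of_nat k)
                       d1 d2 cs)).

(* Bounded exponents and the finite search *)
Local Close Scope N_scope.

Lemma certified_exponent_lt (b c d1 d2 n l : nat) :
  certified b c (N.of_nat d1) (N.of_nat d2) ->
  perrin n + d1 = c * b ^ l + d2 -> l < (certificate b).1.
Proof.
rewrite /certified; case: (certificate b) => [k cs] /= /nilP empty eqn.
rewrite ltnNge; apply/negP => le_kl.
have [] := @covers_sieve (N.of_nat b) (N.of_nat c * N.of_nat b ^ N.of_nat k)
  (N.of_nat d1) (N.of_nat d2) cs n (l - k); last by rewrite empty.
rewrite /perrinN -N.mul_assoc -N.pow_add_r -!Nat2N.inj_add -Nat2N.inj_pow.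
rewrite -Nat2N.inj_mul -Nat2N.inj_add; congr N.of_nat.
have -> : (k + (l - k))%coq_nat = l by lia.
rewrite [LHS]eqn; congr (_ * _ + _).
(* The powers of the standard library and of MathComp remain to be identified. *)
by elim: l {eqn le_kl} => //= l IHl; rewrite expnS IHl.
Qed.

(** The recurrence gives [perrin k.+4 + perrin k = perrin k.+4.+1]. The bound 4 is sharp, as the
    values at 3 and 4 are 3 and 2. *)
Lemma perrin_leq (m n : nat) : 4 <= m <= n -> perrin m <= perrin n.
Proof.
have step k : 4 <= k -> perrin k <= perrin k.+1.
  by case: k => [|[|[|[|k]]]] // _; rewrite !perrinSSS; lia.
case/andP=> m4 /subnKC <-; elim: (n - m) => [|j IHj]; first by rewrite addn0.
by rewrite addnS (leq_trans IHj) // step // (leq_trans m4) // leq_addr.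
Qed.

(* [perrin 17 = 119] exceeds every value left to the finite search. *)
Definition complete (c : nat -> nat) (d1 d2 : nat)
    (sols : seq (nat * nat * nat)) : bool :=
  all (fun t => let: (n, b, l) := t in
         [&& 2 <= b <= 10, 1 <= l & perrin n + d1 == c b * b ^ l + d2]) sols &&
  all (fun b =>
    certified b (c b) (N.of_nat d1) (N.of_nat d2) &&
    all (fun l =>
      let v := c b * b ^ l + d2 in
      (v < perrin 17 + d1) &&
      all (fun n => (perrin n + d1 == v) ==> ((n, b, l) \in sols)) (iota 0 17))
      (iota 1 (certificate b).1.-1)) (iota 2 9).

Lemma completeP (c : nat -> nat) (d1 d2 : nat) (sols : seq (nat * nat * nat)) :
  complete c d1 d2 sols -> forall n b l : nat,
  (2 <= b <= 10 /\ 1 <= l /\ perrin n + d1 = c b * b ^ l + d2) <->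
  (n, b, l) \in sols.
Proof.
case/andP=> /allP sound /allP comp n b l; split=> [[hb [hl eqn]]|/sound].
  have /comp/andP[cert /allP small] : b \in iota 2 9 by rewrite mem_iota; lia.
  have lt_l := certified_exponent_lt cert eqn.
  have /small/andP[lt_v /allP/(_ n)] : l \in iota 1 (certificate b).1.-1.
    by rewrite mem_iota; lia.
  rewrite mem_iota eqn eqxx /=; apply.
  rewrite ltnNge; apply/negP => n17.
  have := @perrin_leq 17 n n17; move: eqn lt_v; set v := c b * _; lia.
by case/and3P=> ? ? /eqP.
Qed.

(** Here [undup] merges solutions sharing a value, as with [perrin 5 = perrin 6]. *)
Lemma perrin_values (f : nat -> nat -> nat) (sols : seq (nat * nat * nat))
    (vals : seq nat) :
  (forall n b l : nat,
    (2 <= b <= 10 /\ 1 <= l /\ perrin n = f b l) <-> (n, b, l) \in sols) ->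
  undup [seq perrin t.1.1 | t <- sols] = vals ->
  forall x : nat,
  ((exists b : nat, 2 <= b <= 10 /\ exists l : nat, 1 <= l /\ x = f b l) /\
   is_perrin x) <-> x \in vals.
Proof.
move=> solsP <- x; rewrite mem_undup; split.
  case=> -[b [hb [l [hl xE]]]] [n xn]; apply/mapP; exists (n, b, l) => //.
  by apply/solsP; rewrite -xn.
case/mapP=> -[[n b] l] /solsP[hb [hl E]] ->; split; last by exists n.
by exists b; split=> //; exists l.
Qed.

(** * The four families *)

Lemma thabit1_complete :
  complete (fun b => b + 1) 1 0 [:: (5, 2, 1); (6, 2, 1); (12, 5, 1)].
Proof. by vm_compute. Qed.

Lemma thabit2_complete : complete (fun b => b + 1) 0 1 [:: (7, 2, 1)].
Proof. by vm_compute. Qed.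

Lemma williams1_complete :
  complete (fun b => b - 1) 1 0
    [:: (0, 2, 2); (3, 2, 2); (5, 3, 1); (6, 3, 1); (7, 2, 3); (10, 3, 2);
        (12, 6, 1)].
Proof. by vm_compute. Qed.

Lemma williams2_complete :
  complete (fun b => b - 1) 0 1
    [:: (0, 2, 1); (3, 2, 1); (5, 2, 2); (6, 2, 2); (7, 3, 1); (10, 2, 4)].
Proof. by vm_compute. Qed.

Lemma completeP_plus1 (c : nat -> nat) (sols : seq (nat * nat * nat)) :
  complete c 0 1 sols -> forall n b l : nat,
  (2 <= b <= 10 /\ 1 <= l /\ perrin n = c b * b ^ l + 1) <->
  (n, b, l) \in sols.
Proof. by move=> /completeP csols n b l; rewrite -csols addn0. Qed.

(** Positivity of [c b] keeps the subtraction from truncating; otherwise [perrin 1 = 0] would match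
    [0 - 1]. *)
Lemma completeP_minus1 (c : nat -> nat) (sols : seq (nat * nat * nat)) :
  (forall b, 2 <= b -> 0 < c b) ->
  complete c 1 0 sols -> forall n b l : nat,
  (2 <= b <= 10 /\ 1 <= l /\ perrin n = c b * b ^ l - 1) <->
  (n, b, l) \in sols.
Proof.
move=> c0 /completeP csols n b l; rewrite -csols addn0.
have pos : 2 <= b <= 10 -> 0 < c b * b ^ l.
  by case/andP=> b2 _; rewrite muln_gt0 c0 // expn_gt0; lia.
move: pos; set v := c b * _ => pos.
by split=> -[hb [hl E]]; have := pos hb; repeat split=> //; lia.
Qed.

Theorem theorem4p1 :
    ((forall n b l : nat,
        (2 <= b <= 10 /\ 1 <= l /\ perrin n = (b + 1) * b ^ l - 1) <->
        (n, b, l) \in [:: (5, 2, 1); (6, 2, 1); (12, 5, 1)])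
     /\
     (forall x : nat,
        ((exists b : nat, 2 <= b <= 10 /\ is_thabit1 b x) /\ is_perrin x) <->
        x \in [:: 5; 29]))
    /\
    ((forall n b l : nat,
        (2 <= b <= 10 /\ 1 <= l /\ perrin n = (b + 1) * b ^ l + 1) <->
        (n, b, l) \in [:: (7, 2, 1)])
     /\
     (forall x : nat,
        ((exists b : nat, 2 <= b <= 10 /\ is_thabit2 b x) /\ is_perrin x) <->
        x \in [:: 7]))
    /\
    ((forall n b l : nat,
        (2 <= b <= 10 /\ 1 <= l /\ perrin n = (b - 1) * b ^ l - 1) <->
        (n, b, l) \in [:: (0, 2, 2); (3, 2, 2); (5, 3, 1); (6, 3, 1); (7, 2, 3);
                        (10, 3, 2); (12, 6, 1)])
     /\
     (forall x : nat,
        ((exists b : nat, 2 <= b <= 10 /\ is_williams1 b x) /\ is_perrin x) <->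
        x \in [:: 3; 5; 7; 17; 29]))
    /\
    ((forall n b l : nat,
        (2 <= b <= 10 /\ 1 <= l /\ perrin n = (b - 1) * b ^ l + 1) <->
        (n, b, l) \in [:: (0, 2, 1); (3, 2, 1); (5, 2, 2); (6, 2, 2); (7, 3, 1);
                        (10, 2, 4)])
     /\
     (forall x : nat,
        ((exists b : nat, 2 <= b <= 10 /\ is_williams2 b x) /\ is_perrin x) <->
        x \in [:: 3; 5; 7; 17])).
Proof.
have T1 := completeP_minus1 (fun b _ => ltn_addl b (ltnSn 0)) thabit1_complete.
have T2 := completeP_plus1 thabit2_complete.
(* The bound [2 <= b] is by definition [1 < b], which equals [0 < b - 1]. *)
have W1 := completeP_minus1 (fun b b2 => etrans (subn_gt0 1 b) b2)
             williams1_complete.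
have W2 := completeP_plus1 williams2_complete.
split; last split; last split; split=> //.
- exact: (perrin_values T1).
- exact: (perrin_values T2).
- exact: (perrin_values W1).
- exact: (perrin_values W2).
Qed.
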